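(* There is an absolute constant $K$ such that the following holds. Let $\varepsilon\in(0,6)$. For all sufficiently large $n$ (depending on $\varepsilon$) and every real normed space $X$ of dimension $n$ there exists an approximately convex set $A\subseteq X$ with $$\mathcal{H}(A,\operatorname{Co}(A))\ge\log_2 n-\varepsilon\qquad\text{and}\qquad\operatorname{diam}(A)\le\frac{K(\log_2 n)^2\sqrt n}{\varepsilon^3}.$$
   Context: A set $A$ is approximately convex if $d(tx+(1-t)y,A)\le1$ for all $x,y\in A$, $t\in[0,1]$, where $d(x,A)=\inf_{a\in A}\|x-a\|$. $\mathcal{H}$ is the Hausdorff distance, $\operatorname{Co}$ the convex hull, $\operatorname{diam}(A)=\sup\{\|x-y\|:x,y\in A\}$. *)

(* Defs.v *)
From HB Require Import structures.
From mathcomp Require Import all_boot all_order all_algebra.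
From mathcomp Require Import all_classical all_reals all_analysis.
From mathcomp Require Import Rstruct Rstruct_topology.
Set Implicit Arguments. Unset Strict Implicit. Unset Printing Implicit Defensive.
Import Order.TTheory GRing.Theory Num.Theory.
Import numFieldNormedType.Exports.
Local Open Scope classical_set_scope.
Local Open Scope ring_scope.

Notation RR := Rdefinitions.R.

Definition has_dim (X : normedModType RR) (n : nat) : Prop :=
  exists b : 'I_n -> X,
    (forall x : X, exists c : 'I_n -> RR, x = \sum_(i < n) c i *: b i) /\
    (forall c : 'I_n -> RR, \sum_(i < n) c i *: b i = 0 -> forall i, c i = 0).

(* d(x,A) = inf_{a in A} ||x - a||, as an extended real (+oo if A is empty). *)
Definition dist_set (X : normedModType RR) (x : X) (A : set X) : \bar RR :=
  ereal_inf [set (`|x - a|)%:E | a in A].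

Definition hausdorff (X : normedModType RR) (A B : set X) : \bar RR :=
  maxe (ereal_sup [set dist_set a B | a in A])
       (ereal_sup [set dist_set b A | b in B]).

Definition conv_hull (X : normedModType RR) (A : set X) : set X :=
  [set x | exists (m : nat) (w : 'I_m -> RR) (p : 'I_m -> X),
     (forall i, 0 <= w i) /\ \sum_(i < m) w i = 1 /\
     (forall i, A (p i)) /\ x = \sum_(i < m) w i *: p i].

Definition diam (X : normedModType RR) (A : set X) : \bar RR :=
  ereal_sup [set (`|x - y|)%:E | x in A & y in A].

Definition approx_convex (X : normedModType RR) (A : set X) : Prop :=
  forall x y : X, A x -> A y -> forall t : RR, 0 <= t <= 1 ->
    (dist_set (t *: x + (1 - t) *: y)%R A <= 1%:E)%E.

Definition log2 (x : RR) : RR := ln x / ln 2.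

(* Main.v *)
Require Import Defs.
From HB Require Import structures.
From mathcomp Require Import all_boot all_order all_algebra.
From mathcomp Require Import all_classical all_reals all_analysis.
From mathcomp Require Import Rstruct Rstruct_topology.
From mathcomp Require Import perm ring lra.
Set Implicit Arguments. Unset Strict Implicit. Unset Printing Implicit Defensive.
Import Order.TTheory GRing.Theory Num.Theory.
Import numFieldNormedType.Exports.
Local Open Scope classical_set_scope.
Local Open Scope ring_scope.

(** The Shannon entropy [H] (in bits) on the simplex is concave, vanishes at the
    vertices, equals [log2 m] at the barycentre, and satisfies
    [H (t x + (1 - t) y) <= t H x + (1 - t) H y + 1].  Hence its graph, placed over
    a simplex with vertices [T v_1, ..., T v_m] and drawn in the direction of a
    unit vector [e], is approximately convex, and the barycentre of the vertices
    is far from it provided that points of low entropy are far away horizontally.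
    Since [H w >= - log2 (\sum w_i^2)], a point with [H w < log2 m - c] has
    Euclidean distance at least of order [sqrt (c / m)] from the barycentre, so
    [T] of order [sqrt n * log2 n] suffices as soon as the [v_i] lie in the unit
    ball and satisfy a lower estimate [`|\sum a_i v_i| >= c(d) (\sum a_i^2)^(1/2)]
    with [m >= (1 - d) n] (a proportional Dvoretzky-Rogers factorization).

    To find such vectors, choose [2 n] points [x_i] of the unit ball almost
    maximizing [det (\sum x_i^T x_i)].  The inverse of this matrix defines a
    Euclidean norm dominated by the given norm, for which the Gram matrix of the
    [x_i] is a projection of rank [n].  The barrier method of Spielman and
    Srivastava extracts from it a well-conditioned principal submatrix of size
    [m]. *)

(** * Restricted invertibility of projections *)

Section QuadraticForms.
Variable R : realFieldType.

Definition qform n (M : 'M[R]_n) (u v : 'rV[R]_n) : R := (u *m M *m v^T) 0 0.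
Definition psd n (M : 'M[R]_n) := M^T = M /\ forall v, 0 <= qform M v v.
Definition posdef n (M : 'M[R]_n) := M^T = M /\ forall v, v != 0 -> 0 < qform M v v.

Lemma qformE n (M : 'M[R]_n) u v :
  qform M u v = \sum_i \sum_j u 0 i * M i j * v 0 j.
Proof.
rewrite /qform mxE exchange_big /=; apply: eq_bigr => j _.
by rewrite !mxE mulr_suml.
Qed.

Lemma qformDl n (M : 'M[R]_n) u v w : qform M (u + v) w = qform M u w + qform M v w.
Proof. by rewrite /qform !mulmxDl mxE. Qed.

Lemma qformDr n (M : 'M[R]_n) u v w : qform M u (v + w) = qform M u v + qform M u w.
Proof. by rewrite /qform linearD /= mulmxDr mxE. Qed.

Lemma qformZl n (M : 'M[R]_n) a u v : qform M (a *: u) v = a * qform M u v.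
Proof. by rewrite /qform -!scalemxAl mxE. Qed.

Lemma qformZr n (M : 'M[R]_n) a u v : qform M u (a *: v) = a * qform M u v.
Proof. by rewrite /qform linearZ /= -scalemxAr mxE. Qed.

Lemma qformC n (M : 'M[R]_n) u v : M^T = M -> qform M u v = qform M v u.
Proof.
move=> sM; rewrite /qform -[LHS]/(_ 0 0) -[in LHS](trmxK (_ *m _ *m _)) mxE.
by rewrite !trmx_mul trmxK sM mulmxA.
Qed.

Lemma qform_mulmx n m (A : 'M[R]_(n, m)) (M : 'M[R]_m) u v :
  qform M (u *m A) (v *m A) = qform (A *m M *m A^T) u v.
Proof. by rewrite /qform trmx_mul !mulmxA. Qed.

Lemma qform_delta n (M : 'M[R]_n) i j : qform M (delta_mx 0 i) (delta_mx 0 j) = M i j.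
Proof. by rewrite /qform trmx_delta -rowE -colE !mxE. Qed.

Lemma qform_scalar n (c : R) (v : 'rV[R]_n) : qform c%:M v v = c * \sum_i v 0 i ^+ 2.
Proof.
rewrite /qform mul_mx_scalar -scalemxAl 2!mxE; congr (_ * _).
by apply: eq_bigr => i _; rewrite mxE expr2.
Qed.

Lemma qformB n (M N : 'M[R]_n) u v : qform (M - N) u v = qform M u v - qform N u v.
Proof. by rewrite /qform mulmxBr mulmxBl !mxE. Qed.

Lemma sum_sqr_gt0 n (v : 'rV[R]_n) : v != 0 -> 0 < \sum_i v 0 i ^+ 2.
Proof.
move=> v0; rewrite lt_neqAle sumr_ge0 ?andbT => [|i _]; last exact: sqr_ge0.
rewrite eq_sym; apply: contra v0 => /eqP/psumr_eq0P E.
apply/eqP/rowP => i; rewrite mxE; apply/eqP; rewrite -sqrf_eq0.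
by apply/eqP; apply: E => // j _; exact: sqr_ge0.
Qed.

Lemma posdef_psd n (M : 'M[R]_n) : posdef M -> psd M.
Proof.
move=> [sM pM]; split=> // v; have [->|/pM/ltW//] := eqVneq v 0.
by rewrite /qform !mul0mx mxE.
Qed.

(** For [c > 0], evaluate the form at its minimizing direction [(c, -b)]. For [c = 0] and [b]
    nonzero, the form is linear in [t] at [s = 1], and the chosen [t] makes it -1. *)
Lemma discriminant_le (a b c : R) :
  (forall s t, 0 <= s ^+ 2 * a + 2 * s * t * b + t ^+ 2 * c) -> b ^+ 2 <= a * c.
Proof.
move=> H; have a0 : 0 <= a by have := H 1 0; lra.
have c0 : 0 <= c by have := H 0 1; lra.
have [c_gt|c_eq] : 0 < c \/ c = 0 by move: c0; rewrite le_eqVlt => /orP[/eqP|]; [right|left].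
  have := H c (- b).
  have -> : c ^+ 2 * a + 2 * c * - b * b + (- b) ^+ 2 * c = c * (a * c - b ^+ 2).
    by ring.
  by rewrite pmulr_rge0 // subr_ge0.
subst c; have [->|b0] := eqVneq b 0; first by rewrite expr0n mulr0.
have := H 1 (- (a + 1) / (2 * b)).
have -> : 1 ^+ 2 * a + 2 * 1 * (- (a + 1) / (2 * b)) * b +
   (- (a + 1) / (2 * b)) ^+ 2 * 0 = -1 :> R by field.
by rewrite ler0N1.
Qed.

Lemma psd_CauchySchwarz n (M : 'M[R]_n) u v :
  psd M -> qform M u v ^+ 2 <= qform M u u * qform M v v.
Proof.
move=> [sM pM]; apply: discriminant_le => s t.
have := pM (s *: u + t *: v).
rewrite qformDl !qformDr !qformZl !qformZr (qformC v u sM).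
by congr (_ <= _); ring.
Qed.

Lemma mxtrace_qform n m (M : 'M[R]_n) (A B : 'M[R]_(m, n)) :
  \tr (A *m M *m B^T) = \sum_i qform M (row i A) (row i B).
Proof.
apply: eq_bigr => i _; rewrite /qform -row_mul mxE [RHS]mxE.
by apply: eq_bigr => j _; rewrite !mxE.
Qed.

Lemma mxtrace_CauchySchwarz n m (M : 'M[R]_n) (A B : 'M[R]_(m, n)) : psd M ->
  \tr (A *m M *m B^T) ^+ 2 <= \tr (A *m M *m A^T) * \tr (B *m M *m B^T).
Proof.
move=> [sM pM]; apply: discriminant_le => s t.
rewrite !mxtrace_qform !mulr_sumr -!big_split /=; apply: sumr_ge0 => i _.
have := pM (s *: row i A + t *: row i B).
rewrite qformDl !qformDr !qformZl !qformZr (qformC (row i B) _ sM).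
by congr (_ <= _); ring.
Qed.

Lemma posdef_diag_gt0 n (M : 'M[R]_n) i : posdef M -> 0 < M i i.
Proof.
move=> [_ pM]; rewrite -qform_delta; apply: pM.
apply/negP => /eqP/rowP/(_ i); rewrite !mxE !eqxx /= => /eqP.
by rewrite oner_eq0.
Qed.

(** The top eigenvalue is at most the trace. No spectral theory is used: summing the nonnegative
    values of the form at [v_j e_i - v_i e_j] over all [i, j] gives twice the difference of the two
    sides. *)
Lemma psd_le_mxtrace n (M : 'M[R]_n) (v : 'rV[R]_n) :
  psd M -> qform M v v <= \tr M * \sum_i v 0 i ^+ 2.
Proof.
move=> [sM pM].
have S : \tr M * (\sum_i v 0 i ^+ 2) = \sum_i \sum_j M i i * v 0 j ^+ 2.
  by rewrite mulr_suml; apply: eq_bigr => i _; rewrite mulr_sumr.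
have S' : \tr M * (\sum_i v 0 i ^+ 2) = \sum_i \sum_j M j j * v 0 i ^+ 2.
  by rewrite S exchange_big.
suff: 0 <= \tr M * (\sum_i v 0 i ^+ 2) + \tr M * (\sum_i v 0 i ^+ 2)
            - 2 * qform M v v by lra.
rewrite {1}S S' qformE mulr_sumr -sumrN -!big_split /=.
apply: sumr_ge0 => i _; rewrite mulr_sumr -sumrN -!big_split /=.
apply: sumr_ge0 => j _.
have := pM (v 0 j *: delta_mx 0 i - v 0 i *: delta_mx 0 j).
rewrite -scaleNr qformDl !qformDr !qformZl !qformZr !qform_delta.
have -> : M j i = M i j by rewrite -[in LHS]sM mxE.
by congr (_ <= _); ring.
Qed.

Lemma posdef_unitmx n (M : 'M[R]_n) : posdef M -> M \in unitmx.
Proof.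
move=> [_ pM]; rewrite -row_free_unit; apply: inj_row_free => v vM0.
apply/eqP; apply: contraT => /pM.
by rewrite /qform vM0 mul0mx mxE ltxx.
Qed.

Lemma posdef_invmx n (M : 'M[R]_n) : posdef M -> posdef (invmx M).
Proof.
move=> pdM; have uM := posdef_unitmx pdM; case: pdM => sM pM.
have sI : (invmx M)^T = invmx M by rewrite trmx_inv sM.
split=> // v v0.
have vI0 : v *m invmx M != 0.
  by apply: contra v0 => /eqP E; rewrite -(mulmxKV uM v) E mul0mx.
by have := pM _ vI0; rewrite qform_mulmx sI mulVmx // mul1mx.
Qed.

(** Gives the lower bound [1 / \tr (invmx M)] for the least eigenvalue, by Cauchy-Schwarz for [v]
    and [v *m invmx M]. It tells how far the barrier can advance. *)
Lemma posdef_ge_mxtrace_inv n (M : 'M[R]_n) (v : 'rV[R]_n) :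
  posdef M -> \sum_i v 0 i ^+ 2 <= \tr (invmx M) * qform M v v.
Proof.
move=> pdM; have uM := posdef_unitmx pdM.
have pI := posdef_psd (posdef_invmx pdM); have psM := posdef_psd pdM.
have [->|v0] := eqVneq v 0.
  rewrite big1 => [|i _]; last by rewrite mxE expr0n.
  by rewrite /qform !mul0mx mxE mulr0.
set s := \sum_i _.
have s_gt0 : 0 < s by exact: sum_sqr_gt0.
have := psd_CauchySchwarz v (v *m invmx M) psM.
have -> : qform M v (v *m invmx M) = s.
  rewrite /qform trmx_mul trmx_inv pdM.1 !mulmxA mulmxK // mxE.
  by apply: eq_bigr => i _; rewrite mxE expr2.
rewrite qform_mulmx trmx_inv pdM.1 mulVmx // mul1mx => H.
have H2 := psd_le_mxtrace v pI.
have := le_trans H (ler_wpM2l (psM.2 v) H2).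
by rewrite -/s mulrA expr2 ler_pM2r // mulrC.
Qed.

Lemma posdef_sub_scalar n (M : 'M[R]_n) t :
  posdef M -> 0 <= t -> t * \tr (invmx M) < 1 -> posdef (M - t%:M).
Proof.
move=> pdM t0 tI; split; first by rewrite linearB /= pdM.1 tr_scalar_mx.
move=> v v0; rewrite qformB qform_scalar subr_gt0.
have q0 := pdM.2 _ v0.
apply: (le_lt_trans (ler_wpM2l t0 (posdef_ge_mxtrace_inv v pdM))).
by rewrite mulrA gtr_pMl.
Qed.

Lemma posdef_minor n (M : 'M[R]_n.+1) i : posdef M -> posdef (row' i (col' i M)).
Proof.
move=> [sM pM]; split.
  by apply/matrixP => j k; rewrite !mxE -[in LHS]sM mxE.
move=> v v0.
(* [w] extends [v] by zero at index [i]. *)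
pose w : 'rV[R]_n.+1 := \row_k (if unlift i k is Some j then v 0 j else 0).
have wl j : w 0 (lift i j) = v 0 j by rewrite mxE liftK.
have wi : w 0 i = 0 by rewrite mxE unlift_none.
have w0 : w != 0.
  by apply: contra v0 => /eqP W; apply/eqP/rowP => j; rewrite -wl W !mxE.
have := pM _ w0; rewrite !qformE (bigD1_ord i) //= big1 ?add0r => [|j _]; last first.
  by rewrite wi !mul0r.
congr (_ < _); apply: eq_bigr => j _; rewrite (bigD1_ord i) //= wi mulr0 add0r.
by apply: eq_bigr => k _; rewrite !wl !mxE.
Qed.

(** The inverse of a principal minor is the Schur complement [J] of the entry [I i i] in the inverse
    [I]; the row and column of [i] lost from the trace add up to the quotient. *)
Lemma mxtrace_inv_minor n (M : 'M[R]_n.+1) i : posdef M ->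
  \tr (invmx (row' i (col' i M))) =
  \tr (invmx M) - (invmx M *m invmx M) i i / invmx M i i.
Proof.
move=> pdM; have uM := posdef_unitmx pdM; set I := invmx M.
have pI := posdef_invmx pdM; have Ii := posdef_diag_gt0 i pI.
have Ii0 : I i i != 0 by rewrite gt_eqF.
have uN := posdef_unitmx (posdef_minor i pdM).
pose J : 'M[R]_n := \matrix_(j, k)
  (I (lift i j) (lift i k) - I (lift i j) i * I i (lift i k) / I i i).
have IM j k : \sum_l I j l * M l k = (j == k)%:R.
  by have := mulVmx uM => /matrixP/(_ j k); rewrite !mxE.
have JN : J *m row' i (col' i M) = 1%:M.
  apply/matrixP => j k; rewrite !mxE.
  have E1 := IM (lift i j) (lift i k); have E2 := IM i (lift i k).
  rewrite (bigD1_ord i) //= in E1; rewrite (bigD1_ord i) //= in E2.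
  rewrite (negPf (neq_lift _ _)) /= in E2.
  rewrite (inj_eq lift_inj) in E1.
  transitivity (\sum_l I (lift i j) (lift i l) * M (lift i l) (lift i k) -
    I (lift i j) i / I i i * \sum_l I i (lift i l) * M (lift i l) (lift i k)).
    rewrite mulr_sumr -sumrB; apply: eq_bigr => l _; rewrite !mxE.
    by ring.
  have -> : \sum_l I i (lift i l) * M (lift i l) (lift i k) = - (I i i * M i (lift i k)).
    by apply/eqP; rewrite -addr_eq0 addrC E2.
  rewrite mulrN opprK -E1; field; exact: Ii0.
have -> : invmx (row' i (col' i M)) = J by rewrite -[RHS](mulmxK uN) JN mul1mx.
rewrite [\tr I](bigD1_ord i) //= {1}/mxtrace.
rewrite mxE (bigD1_ord i) //= mulrDl mulfK // opprD addrACA subrr add0r.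
rewrite mulr_suml -sumrB; apply: eq_bigr => j _; rewrite mxE.
by rewrite (mulrC (I i _)).
Qed.

(* One step of the barrier argument: deleting a suitable index pays for moving
   the barrier from [b] to [b + t] at no cost for the potential
   [\tr (G - b)^-1]. *)
Lemma barrier_step n (G : 'M[R]_n.+1) b t Phi :
  posdef (G - b%:M) -> \tr (invmx (G - b%:M)) <= Phi -> 0 <= t -> t * Phi < 1 ->
  exists i, posdef (row' i (col' i G) - (b + t)%:M) /\
            \tr (invmx (row' i (col' i G) - (b + t)%:M)) <= Phi.
Proof.
move=> pdM trP t0 tP; set M := G - b%:M in pdM trP.
have tM : t * \tr (invmx M) < 1 by apply: le_lt_trans tP; rewrite ler_wpM2l.
have := posdef_sub_scalar pdM t0 tM; set M' := M - _ => pdM'.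
have minorE i : row' i (col' i G) - (b + t)%:M = row' i (col' i M').
  apply/matrixP => j k; rewrite !mxE (inj_eq lift_inj) mulrnDl.
  by ring.
have uM := posdef_unitmx pdM; have uM' := posdef_unitmx pdM'.
set A := invmx M in trP tM; pose A' := invmx M'.
have pA : posdef A by exact: posdef_invmx.
have pA' : posdef A' by exact: posdef_invmx.
have resolvent : A' = A + t *: (A *m A').
  have : A *m (M - M') *m A' = t *: (A *m A').
    by rewrite /M' opprB addrCA subrr addr0 mul_mx_scalar -scalemxAl.
  rewrite mulmxBr mulVmx // mulmxBl mul1mx -mulmxA mulmxV // mulmx1 => <-.
  by rewrite addrC subrK.
have tr1 : \tr A' = \tr A + t * \tr (A *m A').
  by rewrite {1}resolvent mxtraceD mxtraceZ.
have tr2 : \tr (A' *m A') = \tr (A *m A') + t * \tr (A' *m A *m A').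
  rewrite {2}resolvent mulmxDr mxtraceD -scalemxAr mxtraceZ mulmxA.
  by rewrite [\tr (A' *m A)]mxtrace_mulC.
have CS : \tr (A *m A') ^+ 2 <= \tr A * \tr (A' *m A *m A').
  have := @mxtrace_CauchySchwarz _ _ A 1%:M A' (posdef_psd pA).
  by rewrite !mul1mx trmx1 mulmx1 pA'.1.
have trA0 : 0 <= \tr A.
  by apply: sumr_ge0 => i _; apply/ltW/posdef_diag_gt0.
(* Moving the barrier raises the potential by [t * \tr (A *m A')]; this bounds the rise by the
   average gain from a deletion, the index [i] being weighted by [A' i i]. *)
have key : t * \tr (A *m A') * \tr A' <= \tr (A' *m A').
  have tr20 : 0 <= \tr (A' *m A').
    rewrite -[X in _ *m X]pA'.1 -{1}[A']mulmx1 mxtrace_qform.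
    apply: sumr_ge0 => i _; rewrite qform_scalar mul1r sumr_ge0 // => j _.
    exact: sqr_ge0.
  have H : \tr (A *m A') * \tr A' <= \tr (A' *m A') * \tr A.
    rewrite tr1 tr2 -subr_ge0.
    set x := \tr (A *m A') in CS *; set y := \tr (A' *m A *m A') in CS *.
    have -> : (x + t * y) * \tr A - x * (\tr A + t * x) = t * (\tr A * y - x ^+ 2).
      by ring.
    by rewrite mulr_ge0 // subr_ge0.
  rewrite -mulrA; apply: (le_trans (ler_wpM2l t0 H)).
  by rewrite mulrCA ler_piMr // ltW.
(* Averaging: if every deletion failed, multiplying by [A' i i] and summing over [i] would
   contradict [key]. *)
have [i Hi] : exists i, \tr A' - (A' *m A') i i / A' i i <= \tr A.
  apply/existsP; apply: contraT; rewrite negb_exists => /forallP H.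
  suff : \tr (A' *m A') < (\tr A' - \tr A) * \tr A'.
    rewrite {1}tr1 [_ + _ - _]addrAC subrr add0r => /lt_le_trans/(_ key).
    by rewrite ltxx.
  rewrite {1}/mxtrace mulr_sumr; apply: ltr_sum => [|i _].
    by apply/hasP; exists ord0; rewrite ?mem_index_enum.
  have Ai := posdef_diag_gt0 i pA'.
  by have := H i; rewrite -ltNge ltrBrDr -ltrBrDl ltr_pdivrMr.
exists i; rewrite minorE; split; first exact: posdef_minor.
by rewrite mxtrace_inv_minor // (le_trans Hi).
Qed.

Lemma barrier_iter j k (G : 'M[R]_(j + k)) b t Phi :
  posdef (G - b%:M) -> \tr (invmx (G - b%:M)) <= Phi -> 0 <= t -> t * Phi < 1 ->
  exists f : 'I_k -> 'I_(j + k), posdef (mxsub f f G - (b + j%:R * t)%:M).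
Proof.
elim: j => [|j IH] in G b *.
  by move=> pG _ _ _; exists id; rewrite mul0r addr0 mxsub_id.
move=> pG trG t0 tP.
have [i [pGi trGi]] := barrier_step pG trG t0 tP.
have [f pf] := IH _ _ pGi trGi t0 tP.
exists (fun x => lift i (f x)).
rewrite -natr1 mulrDl mul1r [_ * t + t]addrC addrA.
by congr posdef: pf; congr (_ - _); apply/matrixP => x y; rewrite !mxE.
Qed.

Lemma restricted_invertibility n j m (d : R) (P : 'M[R]_(j + m)) : (j + m = n + n)%N ->
  P^T = P -> P *m P = P -> \tr P = n%:R -> (0 < m)%N ->
  0 < d -> m%:R <= (1 - d) * n%:R ->
  exists f : 'I_m -> 'I_(j + m), forall a : 'rV[R]_m,
    d ^+ 2 / 8 * \sum_i a 0 i ^+ 2 <= qform (mxsub f f P) a a.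
Proof.
move=> jm sP iP trP m0 d0 md.
have mR : 0 < m%:R :> R by rewrite ltr0n.
have nR : 0 <= n%:R :> R by rewrite ler0n.
have d1 : d < 1.
  rewrite ltNge; apply/negP => d1; move: (lt_le_trans mR md).
  by rewrite ltNge mulr_le0_ge0 // subr_le0.
have n0 : 0 < n%:R :> R.
  rewrite lt_neqAle nR andbT; apply/negP => /eqP E.
  by move: md; rewrite -E mulr0; lra.
have jR : j%:R = n%:R + n%:R - m%:R :> R by rewrite -natrD -jm natrD addrK.
pose be := d / 2; have be0 : 0 < be by rewrite divr_gt0.
(* [Phi] is the initial potential with barrier at [- be]: [P] has eigenvalues 0 and 1, each [n]
   times, so the trace is [n / be + n / (1 + be)]. *)
pose Phi := n%:R * (1 + 2 * be) / (be * (1 + be)).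
have be1 : 0 < 1 + be by rewrite addr_gt0.
pose M := P - (- be)%:M.
have psP v : 0 <= qform P v v.
  have -> : qform P v v = qform 1%:M (v *m P) (v *m P).
    by rewrite qform_mulmx mulmx1 sP iP.
  by rewrite qform_scalar mul1r sumr_ge0 // => i _; exact: sqr_ge0.
have pdM : posdef M.
  split; first by rewrite linearB /= sP tr_scalar_mx.
  move=> v v0; rewrite qformB qform_scalar mulNr opprK ltr_wpDl // mulr_gt0 //.
  exact: sum_sqr_gt0.
have trM : \tr (invmx M) <= Phi.
  (* [J] acts as [1 / (1 + be)] on the range of [P] and as [1 / be] on its kernel. *)
  pose J := be^-1 *: (1%:M - (1 + be)^-1 *: P).
  have JM : J *m M = 1%:M.
    have ME : M = P + be *: 1%:M by rewrite /M raddfN /= opprK scalemx1.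
    have PM : P *m M = (1 + be) *: P.
      by rewrite ME mulmxDr iP -scalemxAr mulmx1 scalerDl scale1r.
    rewrite /J -scalemxAl mulmxBl mul1mx -scalemxAl PM scalerA mulVf ?gt_eqF //.
    by rewrite scale1r ME addrAC subrr add0r scalerA mulVf ?gt_eqF // scale1r.
  have -> : invmx M = J by rewrite -[RHS](mulmxK (posdef_unitmx pdM)) JM mul1mx.
  rewrite /J mxtraceZ linearB /= mxtraceZ mxtrace1 trP jm natrD le_eqVlt.
  apply/orP; left; apply/eqP; rewrite /Phi; field.
  by rewrite !gt_eqF.
have Phi0 : 0 < Phi by rewrite /Phi divr_gt0 ?mulr_gt0 //; lra.
have j0 : 0 < j%:R :> R by rewrite jR; nra.
(* With this step size, [j] deletions move the barrier from [- d / 2] exactly to [d ^+ 2 / 8]. It is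
   admissible because at least [(1 + d) n] indices are deleted. *)
pose t := (be + d ^+ 2 / 8) / j%:R.
have t0 : 0 <= t.
  by rewrite divr_ge0 ?(ltW j0) // addr_ge0 ?(ltW be0) // divr_ge0 ?sqr_ge0.
have tP : t * Phi < 1.
  rewrite /t mulrAC ltr_pdivrMr // mul1r /Phi.
  rewrite mulrA ltr_pdivrMr ?(mulr_gt0 be0 be1) //.
  have jd : (1 + d) * n%:R <= j%:R by rewrite jR; lra.
  have : (be + d ^+ 2 / 8) * (1 + 2 * be) < (1 + d) * (be * (1 + be)).
    rewrite /be -subr_gt0.
    have -> : (1 + d) * (d / 2 * (1 + d / 2)) - (d / 2 + d ^+ 2 / 8) * (1 + 2 * (d / 2))
      = d ^+ 2 / 8 + d ^+ 3 / 8 by field.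
    by rewrite addr_gt0 // divr_gt0 // exprn_gt0.
  move=> H.
  have := ler_wpM2r (ltW (mulr_gt0 be0 be1)) jd.
  have : n%:R * ((be + d ^+ 2 / 8) * (1 + 2 * be)) < n%:R * ((1 + d) * (be * (1 + be))).
    by rewrite ltr_pM2l.
  set u := be + _; lra.
have [f pf] := barrier_iter pdM trM t0 tP.
exists f => a; have := (posdef_psd pf).2 a.
rewrite qformB qform_scalar subr_ge0 /t mulrCA divff ?mulr1 ?gt_eqF //.
by rewrite addrA addNr add0r.
Qed.
End QuadraticForms.

(** * Almost optimal designs *)

(** Sylvester's identity: multiplying [B] by the unipotent [T] on the left or on the right makes it
    block triangular with the respective determinant. *)
Lemma det_1addM (R : comNzRingType) n k (U : 'M[R]_(n, k)) (W : 'M[R]_(k, n)) :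
  \det (1%:M + U *m W) = \det (1%:M + W *m U).
Proof.
pose B := block_mx 1%:M (- U) W 1%:M.
pose T := block_mx 1%:M U 0 1%:M : 'M[R]_(n + k).
have dT : \det T = 1 by rewrite det_ublock !det1 mulr1.
have -> : \det (1%:M + U *m W) = \det (T *m B).
  by rewrite mulmx_block !mul1mx !mul0mx mulmx1 addNr !add0r det_lblock det1 mulr1.
rewrite det_mulmx mulrC -det_mulmx mulmx_block !mul1mx !mulmx1 mulmx0 addr0.
by rewrite subrr addr0 det_lblock det1 mul1r addrC.
Qed.


Lemma det_block_mx11 (R : comNzRingType) (a b c d : R) :
  \det (block_mx a%:M b%:M c%:M d%:M : 'M[R]_(1 + 1)) = a * d - b * c.
Proof.
pose l : 'I_(1 + 1) := lshift 1 0; pose r : 'I_(1 + 1) := rshift 1 0.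
have det2 (M : 'M[R]_(1 + 1)) : \det M = M l l * M r r - M l r * M r l.
  rewrite (expand_det_row _ l) !big_ord_recl big_ord0 addr0 /cofactor !det_mx11.
  rewrite [in X in X + _]mxE [in X in X + _]mxE [in X in _ + X]mxE [in X in _ + X]mxE /=.
  rewrite /bump /= expr0 mul1r expr1 mulN1r mulrN.
  by congr (_ * _ - _ * _); congr (M _ _); apply: val_inj.
by rewrite det2 block_mxEul block_mxEur block_mxEdl block_mxEdr !mxE !mulr1n.
Qed.

(** Replacing one row of a design by another is a rank-two update of its Gram matrix, so Sylvester's
    identity reduces the change to a 2 by 2 determinant. *)
Lemma det_exchange (R : realFieldType) n (S : 'M[R]_n) (x y : 'rV[R]_n) :
  S^T = S -> S \in unitmx ->
  \det (S - x^T *m x + y^T *m y) = \det S *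
    ((1 - qform (invmx S) x x) * (1 + qform (invmx S) y y) + qform (invmx S) x y ^+ 2).
Proof.
move=> sS uS; set P := invmx S.
have sP : P^T = P by rewrite trmx_inv sS.
pose U : 'M[R]_(n, 1 + 1) := row_mx (- (P *m x^T)) (P *m y^T).
pose W : 'M[R]_(1 + 1, n) := col_mx x y.
have -> : S - x^T *m x + y^T *m y = S *m (1%:M + U *m W).
  rewrite mulmxDr mulmx1 /U /W mul_row_col mulNmx mulmxDr mulmxN !mulmxA.
  by rewrite mulmxV // !mul1mx addrA.
rewrite det_mulmx det_1addM; congr (_ * _).
have -> : 1%:M + W *m U = block_mx (1 - qform P x x)%:M (qform P x y)%:M
   (- qform P y x)%:M (1 + qform P y y)%:M.
  rewrite -[1%:M]/(1%:M : 'M[R]_(1 + 1)) scalar_mx_block /W /U mul_col_row add_block_mx.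
  by congr block_mx; rewrite ?add0r ?mulmxN mulmxA [_ *m _]mx11_scalar -?raddfN -?raddfD.
rewrite det_block_mx11.
by rewrite (qformC y x sP); ring.
Qed.

Lemma det_le_bound (R : realDomainType) n (M : 'M[R]_n) (C : R) :
  (forall i j, `|M i j| <= C) -> \det M <= C ^+ n *+ #|{: 'S_n}|.
Proof.
move=> MC; rewrite -sumr_const; apply: ler_sum => s _.
apply: le_trans (ler_norm _) _; rewrite normrM normrX normrN1 expr1n mul1r.
rewrite normr_prod -[X in C ^+ X]card_ord -prodr_const.
by apply: ler_prod => i _; rewrite normr_ge0 MC.
Qed.

(** The supremum of the determinants is finite by the Leibniz expansion. Asking only for a maximum
    up to the factor [1 + 1 / N] avoids compactness of [B]. *)
Lemma near_optimal_design (R : realType) n N (B : set 'rV[R]_n) (C : R) (A0 : 'M[R]_(N, n)) :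
  (0 < N)%N -> (forall v, B v -> forall i, `|v 0 i| <= C) ->
  (forall i, B (row i A0)) -> 0 < \det (A0^T *m A0) ->
  exists A : 'M[R]_(N, n), [/\ forall i, B (row i A), 0 < \det (A^T *m A) &
    forall A' : 'M[R]_(N, n), (forall i, B (row i A')) ->
      N%:R * \det (A'^T *m A') <= (N%:R + 1) * \det (A^T *m A)].
Proof.
move=> N0 BC BA0 dA0.
pose E := [set \det (A^T *m A) | A in [set A : 'M[R]_(N, n) | forall i, B (row i A)]].
have E0 : E (\det (A0^T *m A0)) by exists A0.
have supE : has_sup E.
  split; first by exists (\det (A0^T *m A0)).
  exists ((C * C *+ N) ^+ n *+ #|{: 'S_n}|) => _ [A BA <-]; apply: det_le_bound => i j.
  rewrite mxE; apply: le_trans (ler_norm_sum _ _ _) _.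
  rewrite -[X in _ *+ X]card_ord -sumr_const; apply: ler_sum => k _.
  rewrite mxE normrM ler_pM //.
    by have := BC _ (BA k) i; rewrite mxE.
  by have := BC _ (BA k) j; rewrite mxE.
set s := sup E.
have s0 : 0 < s by apply: lt_le_trans dA0 _; exact: ub_le_sup supE.2 _ E0.
have NR : 0 < N%:R :> R by rewrite ltr0n.
have N1 : 0 < N%:R + 1 :> R by rewrite addr_gt0.
have [|_ [A BA <-] sA] := @sup_adherent _ E (s / (N%:R + 1)) _ supE.
  by rewrite divr_gt0.
have {}sA : N%:R * s < (N%:R + 1) * \det (A^T *m A).
  move: sA; rewrite -/s -(ltr_pM2l N1) mulrBr [_ * (s / _)]mulrCA divff ?gt_eqF //.
  by rewrite mulr1 mulrDl mul1r addrK.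
exists A; split=> //.
  by rewrite -(pmulr_rgt0 _ N1); apply: lt_trans sA; rewrite mulr_gt0.
move=> A' BA'; apply: le_trans (ltW sA); rewrite ler_pM2l //.
by apply: ub_le_sup supE.2 _ _; exists A'.
Qed.

(* Sum over [i] the inequalities obtained by replacing the [i]-th row by [y]. *)
Lemma design_qform_le1 (R : realType) n N (B : set 'rV[R]_n) (A : 'M[R]_(N, n)) :
  N = (n + n)%N -> (0 < N)%N -> (forall i, B (row i A)) -> 0 < \det (A^T *m A) ->
  (forall A' : 'M[R]_(N, n), (forall i, B (row i A')) ->
      N%:R * \det (A'^T *m A') <= (N%:R + 1) * \det (A^T *m A)) ->
  forall y, B y -> qform (invmx (A^T *m A)) y y <= 1.
Proof.
move=> Nn N0 BA dA opt y By; set S := A^T *m A in dA opt *.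
have sS : S^T = S by rewrite trmx_mul trmxK.
have uS : S \in unitmx by rewrite unitmxE unitfE gt_eqF.
set P := invmx S.
have NR : 0 < N%:R :> R by rewrite ltr0n.
have exch i : N%:R * ((1 - qform P (row i A) (row i A)) * (1 + qform P y y)
     + qform P (row i A) y ^+ 2) <= N%:R + 1.
  pose A' := \matrix_k (if k == i then y else row k A).
  have BA' k : B (row k A') by rewrite rowK; case: ifP.
  have := opt _ BA'.
  have -> : A'^T *m A' = S - (row i A)^T *m row i A + y^T *m y.
    apply/matrixP => j k; rewrite !mxE !big_ord1 !mxE.
    rewrite (bigD1 i) //= [in RHS](bigD1 i) //= !mxE eqxx.
    rewrite (eq_bigr (fun l => A^T j l * A l k)) => [|l /negPf li]; last first.
      by rewrite !mxE li !mxE.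
    by ring.
  by rewrite det_exchange // mulrCA [X in X <= _]mulrC ler_pM2r.
have trq : \sum_i qform P (row i A) (row i A) = n%:R.
  by rewrite -mxtrace_qform mxtrace_mulC mulmxA mulmxV // mxtrace1.
have sq : \sum_i qform P (row i A) y ^+ 2 = qform P y y.
  have -> : qform P y y = ((A *m P *m y^T)^T *m (A *m P *m y^T)) 0 0.
    rewrite !trmx_mul trmxK trmx_inv sS /qform !mulmxA -(mulmxA _ A^T A).
    by rewrite -/S mulmxKV.
  rewrite mxE; apply: eq_bigr => i _; rewrite mxE -expr2; congr (_ ^+ 2).
  by rewrite /qform -!row_mul mxE.
(* With [q = qform P y y] and [N = 2 n] the sum reads [n (1 + q) + q <= 2 n + 1], which is exactly
   [q <= 1]: doubling the number of points absorbs the slack in optimality. *)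
have : \sum_(i < N) ((1 - qform P (row i A) (row i A)) * (1 + qform P y y)
     + qform P (row i A) y ^+ 2) <= \sum_(i < N) ((N%:R + 1) / N%:R).
  by apply: ler_sum => i _; rewrite ler_pdivlMr // mulrC.
rewrite sumr_const card_ord -[_ *+ N]mulr_natl mulrCA divff ?gt_eqF // mulr1.
rewrite big_split /= -mulr_suml sumrB trq sumr_const card_ord sq.
rewrite -/(N%:R) Nn natrD; set q := qform P y y.
have n0 : 0 <= n%:R :> R by [].
by nra.
Qed.

(** * Norms on coordinate space: dominated Euclidean forms and well-conditioned vectors *)

Section NormOnRows.
Variables (R : realType) (n : nat) (p : 'rV[R]_n -> R) (C : R).
Hypothesis p_ge0 : forall v, 0 <= p v.
Hypothesis pZ : forall a v, p (a *: v) = `|a| * p v.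
Hypothesis p_coord : forall (v : 'rV[R]_n) i, `|v 0 i| <= C * p v.
Hypothesis n_gt0 : (0 < n)%N.

Lemma norm_gt0 v : v != 0 -> 0 < p v.
Proof.
move=> v0; rewrite lt_neqAle p_ge0 andbT; apply: contra v0 => /eqP pv.
apply/eqP/rowP => i; rewrite mxE; apply/eqP; rewrite -normr_le0.
by have := p_coord v i; rewrite -pv mulr0.
Qed.

Lemma norm_normalize v : v != 0 -> p ((p v)^-1 *: v) = 1.
Proof.
by move=> /norm_gt0 pv; rewrite pZ ger0_norm ?invr_ge0 // mulVf // gt_eqF.
Qed.

Lemma coord_bound_ball (v : 'rV[R]_n) : p v <= 1 -> forall i, `|v 0 i| <= `|C|.
Proof.
move=> pv i; apply: le_trans (p_coord v i) _; apply: le_trans (ler_norm _) _.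
by rewrite normrM ler_piMr // ger0_norm.
Qed.

Lemma exists_dominated_design N : N = (n + n)%N ->
  exists A : 'M[R]_(N, n), [/\ forall i, p (row i A) <= 1, 0 < \det (A^T *m A) &
    forall y, qform (invmx (A^T *m A)) y y <= p y ^+ 2].
Proof.
move=> Nn; have N0 : (0 < N)%N by rewrite Nn addn_gt0 n_gt0.
pose B := [set v | p v <= 1].
have p0 : p 0 = 0 by rewrite -(scale0r 0) pZ normr0 mul0r.
have [A0 BA0 dA0] : exists2 A0 : 'M[R]_(N, n),
    forall i, B (row i A0) & 0 < \det (A0^T *m A0).
  have d0 i : delta_mx 0 i != 0 :> 'rV[R]_n.
    by apply/eqP => /rowP/(_ i)/eqP; rewrite !mxE !eqxx oner_eq0.
  (* A nondegenerate initial design: the normalized coordinate vectors, padded with [n] zero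
     rows. *)
  subst N; pose c : 'rV[R]_n := \row_i (p (delta_mx 0 i))^-1.
  exists (col_mx (diag_mx c) 0).
    move=> i; rewrite /B /=; case: (split_ordP i) => k ->.
      by rewrite rowKu row_diag_mx mxE norm_normalize.
    by rewrite rowKd row0 p0.
  rewrite tr_col_mx mul_row_col mulmx0 addr0 tr_diag_mx det_mulmx -expr2.
  rewrite exprn_gt0 // det_diag prodr_gt0 // => i _.
  by rewrite mxE invr_gt0 norm_gt0.
have [A [BA dA opt]] := near_optimal_design N0 coord_bound_ball BA0 dA0.
exists A; split=> // y; have [->|y0] := eqVneq y 0.
  by rewrite /qform !mul0mx mxE sqr_ge0.
have := @design_qform_le1 _ _ _ B _ Nn N0 BA dA opt ((p y)^-1 *: y).
rewrite /B /= norm_normalize // lexx => /(_ isT).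
have py := norm_gt0 y0.
by rewrite qformZl qformZr mulrA -expr2 exprVn mulrC ler_pdivrMr ?exprn_gt0 // mul1r.
Qed.

(** The Gram matrix [A *m P *m A^T] of the design in its own Euclidean form is a projection of rank
    [n]; restricted invertibility selects the rows, and domination passes the lower estimate to
    [p]. *)
Lemma well_conditioned_rows m (d : R) :
  (0 < m)%N -> 0 < d -> m%:R <= (1 - d) * n%:R ->
  exists V : 'M[R]_(m, n), (forall i, p (row i V) <= 1) /\
    forall a : 'rV[R]_m, d ^+ 2 / 8 * \sum_i a 0 i ^+ 2 <= p (a *m V) ^+ 2.
Proof.
move=> m0 d0 md.
have mn : (m <= n + n)%N.
  have : 0 <= n%:R :> R by []; rewrite -(ler_nat R) natrD; nra.
have jm : (n + n - m + m = n + n)%N by rewrite subnK.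
have [A [BA dA qA]] := exists_dominated_design jm.
set S := A^T *m A in dA qA; set P := invmx S in qA.
have sS : S^T = S by rewrite trmx_mul trmxK.
have sP : P^T = P by rewrite trmx_inv sS.
have uS : S \in unitmx by rewrite unitmxE unitfE gt_eqF.
have [|||f Hf] := @restricted_invertibility R n _ m d (A *m P *m A^T) jm _ _ _ m0 d0 md.
- by rewrite !trmx_mul trmxK sP mulmxA.
- by rewrite !mulmxA -(mulmxA _ A^T A) -/S mulmxKV.
- by rewrite mxtrace_mulC mulmxA mulmxV // mxtrace1.
exists (rowsub f A); split=> [i|a]; first by rewrite row_rowsub.
apply: le_trans (Hf a) (le_trans _ (qA _)).
by rewrite qform_mulmx trmx_mxsub mul_rowsub_mx -mxsub_mul.
Qed.

(* A functional vanishing on the rows of [V] almost attains its norm at [e]; this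
   replaces an appeal to Hahn-Banach. *)
Lemma almost_norming_vector m (V : 'M[R]_(m, n)) (h : R) : (m < n)%N -> 0 < h ->
  exists e : 'rV[R]_n, p e <= 1 /\
    forall (a : 'rV[R]_m) s, (1 - h) * `|s| <= p (a *m V + s *: e).
Proof.
move=> mn h0.
(* As [m < n], some nonzero linear functional, with coefficient column [c], kills all rows of
   [V]. *)
have [c c0 Vc] : exists2 c : 'cV[R]_n, c != 0 & V *m c = 0.
  have : kermx V^T != 0.
    rewrite kermx_eq0 -row_leq_rank -ltnNge.
    by apply: leq_ltn_trans mn; rewrite mxrank_tr rank_leq_row.
  move=> /rowV0Pn[v vk v0]; exists v^T; first by rewrite trmx_eq0.
  by apply: trmx_inj; rewrite trmx_mul trmxK trmx0; apply/sub_kermxP.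
pose phi (y : 'rV[R]_n) := (y *m c) 0 0.
pose E := [set phi v | v in [set v | p v <= 1]].
have phiZ k y : phi (k *: y) = k * phi y by rewrite /phi -scalemxAl mxE.
have phiD x y : phi (x + y) = phi x + phi y by rewrite /phi mulmxDl mxE.
have ct : c^T != 0 by rewrite trmx_eq0.
have E1 : E (phi ((p c^T)^-1 *: c^T)).
  by exists ((p c^T)^-1 *: c^T) => //=; rewrite norm_normalize.
have phi1 : 0 < phi ((p c^T)^-1 *: c^T).
  rewrite phiZ mulr_gt0 ?invr_gt0 ?norm_gt0 // /phi mxE.
  have [i ci] : exists i, c i 0 != 0.
    apply/existsP; apply: contraT; rewrite negb_exists => /forallP H.
    by case/eqP: c0; apply/colP => i; rewrite mxE; apply/eqP/negPn/H.
  rewrite (bigD1 i) //= ltr_pwDl //.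
    by rewrite mxE -expr2 lt_neqAle sqr_ge0 eq_sym sqrf_eq0 ci.
  by apply: sumr_ge0 => k _; rewrite mxE -expr2 sqr_ge0.
have supE : has_sup E.
  split; first by exists (phi ((p c^T)^-1 *: c^T)).
  exists (\sum_i `|C| * `|c i 0|) => _ [y /= py <-]; rewrite /phi mxE.
  apply: ler_sum => i _; apply: le_trans (ler_norm _) _; rewrite normrM.
  by rewrite ler_wpM2r // coord_bound_ball.
set s := sup E.
have s0 : 0 < s by apply: lt_le_trans phi1 _; exact: ub_le_sup supE.2 _ E1.
have phi_le y : phi y <= s * p y.
  have [->|y0] := eqVneq y 0.
    by rewrite -(scale0r 0) phiZ mul0r mulr_ge0 // ltW.
  have : phi ((p y)^-1 *: y) <= s.
    by apply: ub_le_sup supE.2 _ _; exists ((p y)^-1 *: y) => //=; rewrite norm_normalize.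
  by rewrite phiZ mulrC ler_pdivrMr ?norm_gt0.
have phi_norm y : `|phi y| <= s * p y.
  rewrite ler_norml phi_le andbT lerNl.
  by have := phi_le (- 1 *: y); rewrite phiZ pZ mulN1r normrN1 mul1r.
have [|_ [e pe <-] se] := @sup_adherent _ E (h * s) _ supE; first by rewrite mulr_gt0.
exists e; split=> // a t.
rewrite -(ler_pM2l s0); apply: le_trans (phi_norm _).
have -> : phi (a *m V + t *: e) = t * phi e.
  by rewrite phiD phiZ /phi -mulmxA Vc mulmx0 mxE add0r.
rewrite normrM mulrA mulrC ler_wpM2l //; apply: le_trans (ler_norm _).
by rewrite mulrBr mulr1 mulrC ltW.
Qed.

End NormOnRows.

(** Equivalence of norms: the norm of [L v] is continuous and, by freeness, positive on the compact
    unit sphere of the sup norm, so its minimum there is positive. *)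
Lemma coord_le_norm (R : realType) (X : normedModType R) n (b : 'I_n -> X) :
  (forall c : 'I_n -> R, \sum_(i < n) c i *: b i = 0 -> forall i, c i = 0) ->
  exists C : R, forall (v : 'rV[R]_n) i, `|v 0 i| <= C * `|\sum_j v 0 j *: b j|.
Proof.
case: n b => [|n] b free; first by exists 0 => v [].
pose L (v : 'rV[R]_n.+1) : X := \sum_j v 0 j *: b j.
have LZ a v : L (a *: v) = a *: L v.
  by rewrite /L scaler_sumr; apply: eq_bigr => i _; rewrite mxE scalerA.
have LB u v : L (u - v) = L u - L v.
  by rewrite /L -sumrB; apply: eq_bigr => i _; rewrite !mxE scalerBl.
have coordN (v : 'rV[R]_n.+1) i : `|v 0 i| <= `|v|.
  by rewrite [leRHS]mx_normrE (le_bigmax _ (fun ij => `|v ij.1 ij.2|) (0, i)).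
pose K := \sum_j `|b j|.
have K0 : 0 <= K by apply: sumr_ge0.
have LK v : `|L v| <= K * `|v|.
  rewrite mulr_suml; apply: le_trans (ler_norm_sum _ _ _) _.
  by apply: ler_sum => i _; rewrite normrZ mulrC ler_wpM2l.
have K1 : 0 < K + 1 by rewrite ltr_wpDl.
have cL : continuous (fun v => `|L v|).
  move=> v; apply/(@cvgrPdist_le _ _ _ _ (nbhs_filter v)) => e e0; near=> u.
  apply: le_trans (ler_dist_dist _ _) _; rewrite -LB; apply: le_trans (LK _) _.
  apply: (@le_trans _ _ ((K + 1) * `|v - u|)).
    by rewrite ler_wpM2r // lerDl.
  rewrite mulrC -ler_pdivlMr //; near: u.
  by apply: cvgr_dist_le => //; rewrite divr_gt0.
pose S := [set v : 'rV[R]_n.+1 | `|v| = 1].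
have cS : compact S.
  apply: bounded_closed_compact.
    by exists 1; split => // M M1 v /= ->; exact: ltW.
  have -> : S = (fun v : 'rV[R]_n.+1 => `|v|) @^-1` [set 1] by [].
  apply: closed_comp => [v _|]; first exact: norm_continuous.
  exact: closed_eq.
have S0 : S !=set0.
  have d0 : `|const_mx 1 : 'rV[R]_n.+1| != 0.
    rewrite normr_eq0; apply/eqP => /rowP/(_ ord0); rewrite !mxE => /eqP.
    by rewrite oner_eq0.
  exists (`|const_mx 1 : 'rV[R]_n.+1|^-1 *: const_mx 1).
  by rewrite /S /= normrZ normfV normr_id mulVf.
have [c /set_mem cS1 cmin] := EVT_min_rV S0 cS (continuous_subspaceT cL).
have Lc : 0 < `|L c|.
  rewrite normr_gt0; apply/eqP => /free H.
  have : c = 0 by apply/rowP => i; rewrite mxE H.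
  by move=> E; move: cS1; rewrite /S /= E normr0 => /eqP; rewrite eq_sym oner_eq0.
exists `|L c|^-1 => v i; apply: le_trans (coordN v i) _.
have [->|v0] := eqVneq v 0; first by rewrite normr0 mulr_ge0 ?invr_ge0.
have vp : 0 < `|v| by rewrite normr_gt0.
have : `|L c| <= `|L (`|v|^-1 *: v)|.
  by apply: cmin; apply/mem_set; rewrite /S /= normrZ normfV normr_id mulVf // gt_eqF.
rewrite LZ normrZ normfV normr_id -/(L v) => H.
by rewrite mulrC ler_pdivlMr // mulrC -ler_pdivlMr // mulrC.
Unshelve. all: by end_near.
Qed.

(** * Entropy *)

Section Entropy.
Variable R : realType.
Implicit Types (x y z t : R).

Lemma ln_le_sub1 x : 0 < x -> ln x <= x - 1.
Proof.
move=> x0; have -> : ln x = ln (1 + (x - 1)) by congr ln; ring.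
by apply: le_ln1Dx; lra.
Qed.

(** The convex function [x ln x] lies above its tangent at [z]. The tangents at [1 / m], at a
    mixture and at [1 / 2] yield the maximum of the entropy, its concavity and the bound on binary
    entropy. *)
Lemma mul_ln_ge x z : 0 <= x -> 0 < z -> x * ln z + x - z <= x * ln x.
Proof.
move=> x0 z0; have [->|xn0] := eqVneq x 0; first by lra.
have xp : 0 < x by rewrite lt_neqAle eq_sym xn0.
have := ln_le_sub1 (divr_gt0 z0 xp); rewrite ln_div ?posrE // => H.
have := ler_wpM2l x0 H; rewrite !mulrBr [x * (z / x)]mulrCA divff // !mulr1.
lra.
Qed.

(* In nats: [entropy / ln 2] is the entropy in bits. *)
Definition entropy m (w : 'I_m -> R) : R := - \sum_i w i * ln (w i).
Definition simplex m (w : 'I_m -> R) := (forall i, 0 <= w i) /\ \sum_i w i = 1.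

Lemma simplex_le1 m (w : 'I_m -> R) i : simplex w -> w i <= 1.
Proof.
by move=> [w0 <-]; rewrite (bigD1 i) //= lerDl sumr_ge0.
Qed.

Lemma simplex_mix m t (v w : 'I_m -> R) : 0 <= t <= 1 -> simplex v -> simplex w ->
  simplex (fun i => t * v i + (1 - t) * w i).
Proof.
move=> /andP[t0 t1] [v0 v1] [w0 w1]; split=> [i|].
  by rewrite addr_ge0 // mulr_ge0 // subr_ge0.
by rewrite big_split /= -!mulr_sumr v1 w1; ring.
Qed.

Lemma entropy_ge0 m (w : 'I_m -> R) : simplex w -> 0 <= entropy w.
Proof.
move=> sw; rewrite oppr_ge0; apply: sumr_le0 => i _.
by rewrite mulr_ge0_le0 ?sw.1 // ln_le0 // simplex_le1.
Qed.

Lemma entropy_le_ln m (w : 'I_m -> R) : simplex w -> entropy w <= ln m%:R.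
Proof.
move=> [w0 w1]; have m0 : (0 < m)%N.
  rewrite lt0n; apply/negP => /eqP m0; subst m.
  by move: w1; rewrite big_ord0 => /eqP; rewrite eq_sym oner_eq0.
have mR : 0 < m%:R :> R by rewrite ltr0n.
have : \sum_i (w i * ln m%:R^-1 + w i - m%:R^-1) <= \sum_i w i * ln (w i).
  by apply: ler_sum => i _; rewrite mul_ln_ge // invr_gt0.
rewrite sumrB big_split /= -mulr_suml w1 sumr_const card_ord -[m%:R^-1 *+ m]mulr_natl.
rewrite divff ?gt_eqF // lnV ?posrE // /entropy; lra.
Qed.

(** Shannon entropy dominates collision entropy: Jensen for the logarithm with weights [w i], in the
    form [ln (w i / s) <= w i / s - 1]. *)
Lemma entropy_ge_collision m (w : 'I_m -> R) :
  simplex w -> - ln (\sum_i w i ^+ 2) <= entropy w.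
Proof.
move=> [w0 w1]; set s := \sum_i _.
have s0 : 0 < s.
  rewrite lt_neqAle sumr_ge0 ?andbT => [|i _]; last exact: sqr_ge0.
  apply/negP => /eqP/esym/psumr_eq0P E.
  have : \sum_i w i = 0.
    apply: big1 => i _; apply/eqP; rewrite -sqrf_eq0; apply/eqP/E => // j _.
    exact: sqr_ge0.
  by rewrite w1 => /eqP; rewrite oner_eq0.
rewrite lerN2.
have : \sum_i w i * ln (w i) <= \sum_i (w i * ln s + (w i ^+ 2 / s - w i)).
  apply: ler_sum => i _; have [->|wi] := eqVneq (w i) 0; first by lra.
  have wp : 0 < w i by rewrite lt_neqAle eq_sym wi w0.
  have := ler_wpM2l (w0 i) (ln_le_sub1 (divr_gt0 wp s0)).
  by rewrite ln_div ?posrE // !mulrBr mulrA -expr2 mulr1; lra.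
rewrite big_split sumrB /= -!mulr_suml w1 divff ?gt_eqF //.
lra.
Qed.

Lemma entropy_concave m t (v w : 'I_m -> R) : 0 <= t <= 1 -> simplex v -> simplex w ->
  t * entropy v + (1 - t) * entropy w <= entropy (fun i => t * v i + (1 - t) * w i).
Proof.
move=> /andP[t0 t1] [v0 _] [w0 _].
rewrite /entropy !mulrN -opprD lerN2 !mulr_sumr -big_split /=.
apply: ler_sum => i _; set z := _ + _.
have z0 : 0 <= z by rewrite addr_ge0 // mulr_ge0 // subr_ge0.
have [zz|zn] := eqVneq z 0.
  have tv := mulr_ge0 t0 (v0 i).
  have tw : 0 <= (1 - t) * w i by rewrite mulr_ge0 // subr_ge0.
  rewrite zz mul0r !mulrA.
  have -> : t * v i = 0 by move: zz; rewrite /z; lra.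
  have -> : (1 - t) * w i = 0 by move: zz; rewrite /z; lra.
  by rewrite !mul0r addr0.
have zp : 0 < z by rewrite lt_neqAle eq_sym zn.
have H1 := ler_wpM2l t0 (mul_ln_ge (v0 i) zp).
have H2 : (1 - t) * (w i * ln z + w i - z) <= (1 - t) * (w i * ln (w i)).
  by rewrite ler_wpM2l ?mul_ln_ge // subr_ge0.
have -> : z * ln z = t * (v i * ln z + v i - z) + (1 - t) * (w i * ln z + w i - z).
  by rewrite /z; ring.
lra.
Qed.

(** The mixture is at least each of its summands [t x] and [(1 - t) y], so its logarithm is at least
    theirs. Summed over coordinates, mixing adds at most the binary entropy of [t]. *)
Lemma mul_ln_mix_ge x y t : 0 <= t <= 1 -> 0 <= x -> 0 <= y ->
  x * (t * ln t) + y * ((1 - t) * ln (1 - t)) + t * (x * ln x) + (1 - t) * (y * ln y)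
  <= (t * x + (1 - t) * y) * ln (t * x + (1 - t) * y).
Proof.
move=> /andP[t0 t1] x0 y0.
have t1' : 0 <= 1 - t by rewrite subr_ge0.
set z := t * x + _.
have H a b : 0 <= a -> 0 <= b -> a * b <= z ->
    b * (a * ln a) + a * (b * ln b) <= a * b * ln z.
  move=> a0 b0 abz; have [->|an] := eqVneq a 0; first by lra.
  have [->|bn] := eqVneq b 0; first by lra.
  have ap : 0 < a by rewrite lt_neqAle eq_sym an.
  have bp : 0 < b by rewrite lt_neqAle eq_sym bn.
  have abp : 0 < a * b by rewrite mulr_gt0.
  have : ln (a * b) <= ln z by rewrite ler_ln ?posrE // (lt_le_trans abp).
  move=> /(ler_wpM2l (mulr_ge0 a0 b0)); rewrite lnM ?posrE //; lra.
have H1 : x * (t * ln t) + t * (x * ln x) <= t * x * ln z.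
  by apply: H => //; rewrite lerDl mulr_ge0.
have H2 : y * ((1 - t) * ln (1 - t)) + (1 - t) * (y * ln y) <= (1 - t) * y * ln z.
  by apply: H => //; rewrite lerDr mulr_ge0.
rewrite [z * _]mulrDl; lra.
Qed.

Lemma binary_entropy_ge t : 0 <= t <= 1 -> - ln 2 <= t * ln t + (1 - t) * ln (1 - t).
Proof.
move=> /andP[t0 t1].
have h : 0 < 2^-1 :> R by rewrite invr_gt0.
have H1 := mul_ln_ge t0 h.
have H2 : (1 - t) * ln 2^-1 + (1 - t) - 2^-1 <= (1 - t) * ln (1 - t).
  by apply: mul_ln_ge => //; rewrite subr_ge0.
move: H1 H2; rewrite lnV ?posrE //; lra.
Qed.

Lemma entropy_approx_convex m t (v w : 'I_m -> R) :
  0 <= t <= 1 -> simplex v -> simplex w ->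
  entropy (fun i => t * v i + (1 - t) * w i) <= t * entropy v + (1 - t) * entropy w + ln 2.
Proof.
move=> t01 [v0 v1] [w0 w1].
have : \sum_i (v i * (t * ln t) + w i * ((1 - t) * ln (1 - t)) + t * (v i * ln (v i)) +
   (1 - t) * (w i * ln (w i))) <=
   \sum_i (t * v i + (1 - t) * w i) * ln (t * v i + (1 - t) * w i).
  by apply: ler_sum => i _; apply: mul_ln_mix_ge.
rewrite !big_split /= -!mulr_suml -!mulr_sumr v1 w1 !mul1r.
have := binary_entropy_ge t01; rewrite /entropy; lra.
Qed.

End Entropy.

(** * The approximately convex set *)

Lemma well_conditioned_system (X : normedModType RR) n m (d h : RR) :
  has_dim X n -> (0 < m)%N -> 0 < d -> m%:R <= (1 - d) * n%:R -> 0 < h ->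
  exists (v : 'I_m -> X) (e : X), [/\ forall i, `|v i| <= 1, `|e| <= 1,
    forall (a : 'I_m -> RR) s, (1 - h) * `|s| <= `|\sum_i a i *: v i + s *: e| &
    forall a : 'I_m -> RR, d ^+ 2 / 8 * \sum_i a i ^+ 2 <= `|\sum_i a i *: v i| ^+ 2].
Proof.
move=> [b [_ free]] m0 d0 md h0.
have [C HC] := coord_le_norm free.
pose Lb (v : 'rV[RR]_n) : X := \sum_j v 0 j *: b j.
have LZ a v : Lb (a *: v) = a *: Lb v.
  by rewrite /Lb scaler_sumr; apply: eq_bigr => i _; rewrite mxE scalerA.
have LD u v : Lb (u + v) = Lb u + Lb v.
  by rewrite /Lb -big_split; apply: eq_bigr => i _; rewrite !mxE scalerDl.
have LM k (a : 'rV[RR]_k) (V : 'M[RR]_(k, n)) : Lb (a *m V) = \sum_i a 0 i *: Lb (row i V).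
  rewrite /Lb; under eq_bigr do rewrite mxE scaler_suml.
  rewrite exchange_big /=; apply: eq_bigr => i _; rewrite scaler_sumr.
  by apply: eq_bigr => j _; rewrite mxE scalerA.
pose p v := `|Lb v|.
have p0 v : 0 <= p v by exact: normr_ge0.
have pZ a v : p (a *: v) = `|a| * p v by rewrite /p LZ normrZ.
have mR : 0 < m%:R :> RR by rewrite ltr0n.
have nR : 0 <= n%:R :> RR by [].
have mn : (m < n)%N by rewrite -(ltr_nat RR); nra.
have n0 : (0 < n)%N by exact: leq_trans mn.
have [V [pV HV]] := well_conditioned_rows p0 pZ HC n0 m0 d0 md.
have [e [pe He]] := almost_norming_vector p0 pZ HC V mn h0.
exists (fun i => Lb (row i V)), (Lb e); split=> // [a s|a].
  have := He (\row_i a i) s; rewrite /p LD LZ LM.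
  by under eq_bigr do rewrite mxE.
have := HV (\row_i a i); rewrite /p LM.
under eq_bigr do rewrite mxE.
by under [X in `|X|]eq_bigr do rewrite mxE.
Qed.

Section EntropySet.
Variables (X : normedModType RR) (m : nat) (v : 'I_m -> X) (e : X) (T : RR).
Hypothesis m_gt0 : (0 < m)%N.
Hypothesis v_le1 : forall i, `|v i| <= 1.
Hypothesis e_le1 : `|e| <= 1.
Hypothesis T_ge0 : 0 <= T.

Let ln2_gt0 : 0 < ln 2 :> RR.
Proof. by rewrite ln_gt0 // ltr1n. Qed.

Definition entropy_point (w : 'I_m -> RR) : X :=
  T *: (\sum_i w i *: v i) + (entropy w / ln 2) *: e.

Definition entropy_set : set X := [set x | exists2 w, simplex w & x = entropy_point w].

Lemma entropy_pointB (u w : 'I_m -> RR) : entropy_point u - entropy_point w =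
  T *: (\sum_i (u i - w i) *: v i) + ((entropy u - entropy w) / ln 2) *: e.
Proof.
rewrite /entropy_point opprD addrACA -scalerBr -sumrB -scalerBl -mulrBl.
by under [in RHS]eq_bigr do rewrite scalerBl.
Qed.

Lemma entropy_set_approx_convex : approx_convex entropy_set.
Proof.
move=> _ _ [u su ->] [w sw ->] t t01; set z := fun i => t * u i + (1 - t) * w i.
have sz : simplex z by exact: simplex_mix.
apply: (@le_trans _ _ (`|t *: entropy_point u + (1 - t) *: entropy_point w - entropy_point z|)%:E).
  by apply: ereal_inf_lbound; exists (entropy_point z) => //; exists z.
(* The horizontal parts cancel; what remains is the concavity gap of the entropy, between 0 and 1
   bit. *)
have -> : t *: entropy_point u + (1 - t) *: entropy_point w - entropy_point z =
  ((t * entropy u + (1 - t) * entropy w - entropy z) / ln 2) *: e.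
  rewrite /entropy_point !scalerDr [X in X - _]addrACA opprD [LHS]addrACA.
  have -> : t *: (T *: \sum_i u i *: v i) + (1 - t) *: (T *: \sum_i w i *: v i) =
     T *: \sum_i z i *: v i.
    rewrite !scalerA ![_ * T]mulrC -!scalerA -scalerDr; congr (_ *: _).
    rewrite !scaler_sumr -big_split.
    by apply: eq_bigr => i _; rewrite !scalerA scalerDl.
  by rewrite subrr add0r !scalerA -scalerDl -scalerBl; congr (_ *: _); field; rewrite gt_eqF.
rewrite lee_fin normrZ -[leRHS]mulr1 ler_pM // normrM normfV (gtr0_norm ln2_gt0).
rewrite ler_pdivrMr // mul1r ler_norml.
have := entropy_concave t01 su sw; have := entropy_approx_convex t01 su sw.
by rewrite -/z => H1 H2; apply/andP; split; lra.
Qed.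

(** Two probability vectors have l1 distance at most 2, and the heights lie between 0 and
    [log2 m]. *)
Lemma entropy_set_diam : (diam entropy_set <= (2 * T + ln m%:R / ln 2)%:E)%E.
Proof.
apply/ereal_supP => _ [_ [u su ->] [_ [w sw ->] <-]].
rewrite lee_fin entropy_pointB; apply: le_trans (ler_normD _ _) _; apply: lerD.
  rewrite normrZ ger0_norm // mulrC ler_wpM2r //.
  apply: le_trans (ler_norm_sum _ _ _) _.
  apply: (@le_trans _ _ (\sum_i (u i + w i))).
    apply: ler_sum => i _; rewrite normrZ -[leRHS]mulr1 ler_pM //.
    by apply: le_trans (ler_normB _ _) _; rewrite !ger0_norm // ?su.1 ?sw.1.
  by rewrite big_split /= su.2 sw.2.
rewrite normrZ -[leRHS]mulr1 ler_pM // normrM normfV (gtr0_norm ln2_gt0).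
rewrite ler_pM2r ?invr_gt0 // ler_norml.
have := entropy_ge0 su; have := entropy_ge0 sw.
have := entropy_le_ln su; have := entropy_le_ln sw.
by move=> ? ? ? ?; apply/andP; split; lra.
Qed.

Lemma vertex_in_entropy_set i : entropy_set (T *: v i).
Proof.
exists (fun j => (j == i)%:R).
  split=> [j|]; first exact: ler0n.
  by rewrite (bigD1 i) //= eqxx big1 ?addr0 // => j /negPf ->.
rewrite /entropy_point (bigD1 i) //= eqxx scale1r big1 ?addr0 => [|j /negPf ->]; last first.
  by rewrite scale0r.
rewrite /entropy big1 ?oppr0 ?mul0r ?scale0r ?addr0 // => j _.
by case: (j == i); rewrite ?ln1 ?mulr0 ?mul0r.
Qed.

(** The barycentre of the vertices [T *: v i], which lie in the set at height 0, is the witness in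
    the convex hull. *)
Lemma hausdorff_entropy_set (r : RR) :
  (forall w, simplex w -> r <= `|T *: (\sum_i m%:R^-1 *: v i) - entropy_point w|) ->
  (r%:E <= hausdorff entropy_set (conv_hull entropy_set))%E.
Proof.
move=> H; have mR : 0 < m%:R :> RR by rewrite ltr0n.
rewrite /hausdorff le_max; apply/orP; right.
apply: (@le_trans _ _ (dist_set (T *: (\sum_i m%:R^-1 *: v i)) entropy_set)).
  by apply/ereal_infP => _ [_ [w sw ->] <-]; rewrite lee_fin; exact: H.
apply: ereal_sup_ubound; exists (T *: (\sum_i m%:R^-1 *: v i)) => //.
exists m, (fun=> m%:R^-1), (fun i => T *: v i); split=> [i|]; first by rewrite invr_ge0.
split; first by rewrite sumr_const card_ord -[_ *+ m]mulr_natl divff // gt_eqF.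
split; first exact: vertex_in_entropy_set.
by rewrite scaler_sumr; apply: eq_bigr => i _; rewrite !scalerA mulrC.
Qed.

End EntropySet.

(** * Distance from the barycentre and choice of parameters *)

Lemma low_entropy_dist (R : realType) m (w : 'I_m -> R) (x : R) : (0 < m)%N ->
  simplex w -> entropy w < ln m%:R - x -> x / m%:R <= \sum_i (m%:R^-1 - w i) ^+ 2.
Proof.
move=> m0 sw Hw; have mR : 0 < m%:R :> R by rewrite ltr0n.
have mV : 0 < m%:R^-1 :> R by rewrite invr_gt0.
set s := \sum_i w i ^+ 2.
(* The variance identity. The collision bound then gives [x < ln (m s) <= m s - 1]. *)
have sE : \sum_i (m%:R^-1 - w i) ^+ 2 = s - m%:R^-1.
  under eq_bigr do rewrite sqrrB.
  rewrite big_split sumrB /= sumr_const card_ord -/s.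
  have -> : \sum_i (m%:R^-1 * w i *+ 2) = m%:R^-1 *+ 2 :> R.
    by rewrite sumrMnl -mulr_sumr sw.2 mulr1.
  rewrite -[_ ^+ 2 *+ m]mulr_natl expr2 mulrA divff ?gt_eqF //.
  by ring.
have sp : 0 < s.
  apply: lt_le_trans mV _; rewrite -subr_ge0 -sE.
  by apply: sumr_ge0 => i _; exact: sqr_ge0.
have := entropy_ge_collision sw; rewrite -/s => H.
have := ln_le_sub1 (mulr_gt0 mR sp); rewrite lnM ?posrE // => H2.
rewrite sE ler_pdivrMr // mulrBl mulVf ?gt_eqF // mulrC; lra.
Qed.

Theorem theorem4p4 :
  exists K : RR, forall eps : RR, 0 < eps < 6 ->
    exists N : nat, forall (n : nat), (N <= n)%N ->
      forall (X : normedModType RR), has_dim X n ->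
        exists A : set X, approx_convex A /\
          (hausdorff A (conv_hull A) >= (log2 n%:R - eps)%:E)%E /\
          (diam A <= (K * (log2 n%:R) ^+ 2 * Num.sqrt (n%:R) / eps ^+ 3)%:E)%E.
Proof.
(* [K = 1] suffices: the diameter is of order [log2 n * sqrt n], with a factor depending on [eps];
   for large [n] the second [log2 n] pays for that factor. *)
exists 1 => eps /andP[eps0 _].
have ln2_gt0 : 0 < ln 2 :> RR by rewrite ln_gt0 // ltr1n.
(* Chosen so that [log2 (1 - 2 d) = - eps / 4]: keeping only [m >= (1 - 2 d) n] vectors costs at
   most [eps / 4] bits. *)
pose d : RR := (1 - expR (- (eps / 4 * ln 2))) / 2.
have e1 : expR (- (eps / 4 * ln 2)) < 1 :> RR.
  by rewrite expR_lt1 oppr_lt0 mulr_gt0 // divr_gt0.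
have e0 := expR_gt0 (- (eps / 4 * ln 2)).
have dE : 1 - 2 * d = expR (- (eps / 4 * ln 2)) by rewrite /d; field.
have d0 : 0 < d by rewrite divr_gt0 // subr_gt0.
have d1 : d < 1 / 2 by lra.
(* An entropy deficit above [eps / 2] bits will force horizontal distance at least [sqrt (k / m)]
   before scaling by [T]. *)
pose k : RR := d ^+ 2 / 8 * (eps / 2 * ln 2).
have k0 : 0 < k.
  by rewrite mulr_gt0 //; [rewrite divr_gt0 ?exprn_gt0|rewrite mulr_gt0 ?divr_gt0].
have sk0 : 0 < Num.sqrt k by rewrite sqrtr_gt0.
pose G : RR := eps ^+ 3 * (4 / Num.sqrt k + 1).
(* The three summands ensure [d n >= 1], [log2 n >= G] and [n >= 2]. *)
exists ((Num.truncn d^-1).+1 + (Num.truncn (expR (G * ln 2))).+1 + 2)%N => n Nn X dimX.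
have nR : 2 <= n%:R :> RR by rewrite ler_nat (leq_trans _ Nn) // leq_addl.
have n0 : 0 < n%:R :> RR by lra.
have nd : d^-1 <= n%:R.
  apply/ltW/(lt_le_trans (truncnS_gt _)); rewrite ler_nat (leq_trans _ Nn) //.
  by rewrite -addnA leq_addr.
have nG : expR (G * ln 2) <= n%:R.
  apply/ltW/(lt_le_trans (truncnS_gt _)); rewrite ler_nat (leq_trans _ Nn) //.
  by rewrite addnAC leq_addl.
pose l : RR := log2 n%:R.
have lE : l * ln 2 = ln n%:R by rewrite /l /log2 mulfVK // gt_eqF.
have lG : G <= l.
  by rewrite -(ler_pM2r ln2_gt0) lE -[leLHS]expRK ler_ln ?posrE ?expR_gt0.
have G0 : 0 < G by rewrite mulr_gt0 ?exprn_gt0 // addr_gt0 // divr_gt0.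
have l0 : 0 < l by exact: lt_le_trans lG.
pose m := Num.truncn ((1 - d) * n%:R).
have m_le : m%:R <= (1 - d) * n%:R.
  by rewrite truncn_le mulr_ge0 // subr_ge0; lra.
have m_gt : (1 - d) * n%:R < m%:R + 1 by rewrite natr1 truncnS_gt.
have dn1 : 1 <= d * n%:R by rewrite mulrC -ler_pdivrMr // mul1r.
have m_ge : (1 - 2 * d) * n%:R <= m%:R by lra.
have m12 : 0 < (1 - 2 * d) * n%:R by rewrite mulr_gt0 // dE.
have mR : 0 < m%:R :> RR by exact: lt_le_trans m_ge.
have m0 : (0 < m)%N by rewrite -(ltr0n RR).
have lm_ge : ln n%:R - eps / 4 * ln 2 <= ln m%:R.
  apply: (@le_trans _ _ (ln ((1 - 2 * d) * n%:R))); last by rewrite ler_ln ?posrE.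
  by rewrite dE lnM ?posrE // expRK addrC.
have mn : m%:R <= n%:R :> RR by nra.
have lm_le : ln m%:R <= ln n%:R :> RR by rewrite ler_ln ?posrE.
(* Heights are at most [l], so the relative loss [h] in the norming vector costs at most
   [eps / 4]. *)
pose h : RR := eps / (4 * l).
have h0 : 0 < h by rewrite divr_gt0 // mulr_gt0.
have [v [e [v1 ne1 ve vv]]] := well_conditioned_system dimX m0 d0 m_le h0.
(* Scales the distance [sqrt (k / m)] to [2 l], which leaves [l] after subtracting a height of at
   most [l]. *)
pose T : RR := 2 * l * (Num.sqrt m%:R / Num.sqrt k).
have sm0 : 0 < Num.sqrt m%:R :> RR by rewrite sqrtr_gt0.
have T0 : 0 <= T by rewrite mulr_ge0 ?divr_ge0 ?sqrtr_ge0 // mulr_ge0 // ltW.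
exists (entropy_set v e T); split; first exact: entropy_set_approx_convex.
split; last first.
  apply: le_trans (entropy_set_diam v1 ne1 T0) _; rewrite lee_fin -/l mul1r.
  have sn1 : 1 <= Num.sqrt n%:R :> RR.
    by rewrite -[leLHS]sqrtr1 ler_sqrt ?(ltW n0) //; lra.
  have smn : Num.sqrt m%:R <= Num.sqrt n%:R :> RR by rewrite ler_sqrt // ltW.
  apply: (@le_trans _ _ (l * Num.sqrt n%:R * (4 / Num.sqrt k + 1))).
    rewrite mulrDr mulr1; apply: lerD.
      have -> : 2 * T = l * Num.sqrt m%:R * (4 / Num.sqrt k) by rewrite /T; ring.
      by rewrite ler_wpM2r ?divr_ge0 ?sqrtr_ge0 // ler_wpM2l // ltW.
    apply: (@le_trans _ _ l); first by rewrite ler_pdivrMr // lE.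
    by rewrite ler_peMr // ltW.
  rewrite ler_pdivlMr ?exprn_gt0 // expr2.
  have -> : l * Num.sqrt n%:R * (4 / Num.sqrt k + 1) * eps ^+ 3 = l * Num.sqrt n%:R * G.
    by rewrite /G; ring.
  have -> : l * l * Num.sqrt n%:R = l * Num.sqrt n%:R * l by ring.
  by rewrite ler_wpM2l // mulr_ge0 ?sqrtr_ge0 // ltW.
apply: hausdorff_entropy_set => // w sw.
have H0 := entropy_ge0 sw; have H1 := entropy_le_ln sw.
pose y := \sum_i (m%:R^-1 - w i) *: v i; pose H := entropy w / ln 2.
have HE : H * ln 2 = entropy w by rewrite /H mulfVK // gt_eqF.
have H_ge0 : 0 <= H by rewrite divr_ge0 // ltW.
have H_le : H <= l by rewrite ler_pdivrMr // lE (le_trans H1).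
have -> : T *: (\sum_i m%:R^-1 *: v i) - entropy_point v e T w = T *: y + (- H) *: e.
  rewrite /entropy_point opprD addrA -scalerBr -sumrB scaleNr; congr (_ *: _ - _).
  by apply: eq_bigr => i _; rewrite scalerBl.
(* Points of low entropy are far horizontally. For the others the height is at least
   [l - 3 eps / 4], and [ve] retains all but [eps / 4] of it. *)
have [Hlow|Hhigh] := ltP (entropy w) (ln m%:R - eps / 2 * ln 2).
  have yk : Num.sqrt k / Num.sqrt m%:R <= `|y|.
    rewrite -(@ler_pXn2r _ 2) ?nnegrE ?divr_ge0 ?sqrtr_ge0 //.
    rewrite expr_div_n !sqr_sqrtr ?(ltW k0) ?(ltW mR) //; apply: le_trans (vv _).
    rewrite /k -[leLHS]mulrA ler_wpM2l ?divr_ge0 ?sqr_ge0 //.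
    exact: low_entropy_dist.
  have Ty : 2 * l <= `|T *: y|.
    rewrite normrZ ger0_norm //; apply: le_trans (ler_wpM2l T0 yk).
    have -> : T * (Num.sqrt k / Num.sqrt m%:R) = 2 * l.
      by rewrite /T; field; rewrite !gt_eqF.
    by [].
  have He : `|(- H) *: e| <= l.
    rewrite normrZ normrN ger0_norm //; apply: le_trans H_le.
    by rewrite ler_piMr.
  have := lerB_normD (T *: y) (- H *: e).
  by move: Ty He; rewrite -/l; lra.
have -> : T *: y = \sum_i (T * (m%:R^-1 - w i)) *: v i.
  by rewrite scaler_sumr; apply: eq_bigr => i _; rewrite scalerA.
apply: le_trans (ve _ _); rewrite normrN ger0_norm // -/l.
have hH : h * H <= eps / 4.
  apply: le_trans (ler_wpM2l (ltW h0) H_le) _.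
  have -> : h * l = eps / 4 by rewrite /h; field; rewrite gt_eqF.
  by [].
have : l - eps * (3 / 4) <= H.
  rewrite -(ler_pM2r ln2_gt0) HE mulrBl lE; lra.
by move: hH; rewrite mulrBl mul1r; lra.
Qed.
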